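(* Let $(A,\rightarrow)$ be a probabilistic abstract reduction system satisfying the diamond property. Then: (1) (Uniqueness of normal forms) for all $\mu,\rho,\tau\in\mathcal{D}(A)$ and $k\in\mathbb{N}$, if $\mu\rightrightarrows^k\rho$ and $\mu\rightrightarrows^k\tau$ then $\rho^\circ=\tau^\circ$; (2) (Uniformity) for every $p\in[0,1]$ and every $\mu\in\mathcal{D}(A)$, if $\mu$ weakly $p$-normalizes then $\mu$ strongly $p$-normalizes; that is, $\rightarrow$ is uniform.
   Context: For a set $A$, $\mathcal{D}(A)$ is the set of (sub)probability distributions on $A$: functions $\mu:A\to[0,1]$ with $\sum_{a\in A}\mu(a)\le 1$; $\mathrm{supp}(\mu)=\{a:\mu(a)\neq 0\}$. A probabilistic abstract reduction system (PARS) is a pair $(A,\rightarrow)$ with $\rightarrow\subseteq A\times\mathcal{D}(A)$ such that $\mathrm{supp}(\mu)$ is finite whenever $a\rightarrow\mu$. An element $a$ is terminal if there is no $\mu$ with $a\rightarrow\mu$. For $\mu\in\mathcal{D}(A)$ let $\mu^\circ(a)=\mu(a)$ if $a$ is terminal and $0$ otherwise, and $\bar\mu=\mu-\mu^\circ$; $\mathrm{NF}(\mu)=\sum_{a\in A}\mu^\circ(a)$. The relation $\rightrightarrows\subseteq\mathcal{D}(A)\times\mathcal{D}(A)$ is defined by: $\mu\rightrightarrows\mu^\circ+\sum_{a\in\mathrm{supp}(\bar\mu)}\mu(a)\cdot\rho_a$ whenever, for each $a\in\mathrm{supp}(\bar\mu)$, $\rho_a$ is some distribution with $a\rightarrow\rho_a$.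 $\mu\rightrightarrows^n\rho$ means $\rho$ is reached from $\mu$ in exactly $n\ge0$ steps of $\rightrightarrows$, and $\rightrightarrows^*$ means some finite number of steps. The diamond property: whenever $\mu\rightrightarrows\nu$ and $\mu\rightrightarrows\xi$, then (1) $\nu^\circ=\xi^\circ$ and (2) there exists $\rho$ with $\nu\rightrightarrows\rho$ and $\xi\rightrightarrows\rho$. For $p\in[0,1]$, $\mu$ weakly $p$-normalizes if there exists $\rho$ with $\mu\rightrightarrows^*\rho$ and $\mathrm{NF}(\rho)\ge p$; $\mu$ strongly $p$-normalizes if there exists $n$ such that for all $\rho$, $\mu\rightrightarrows^n\rho$ implies $\mathrm{NF}(\rho)\ge p$. The relation $\rightarrow$ is uniform if for every $p$ and every $\mu$, weak $p$-normalization implies strong $p$-normalization. *)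

(* Defs.v *)
From HB Require Import structures.
From mathcomp Require Import all_boot all_order all_algebra.
From mathcomp Require Import all_classical all_reals all_analysis.

Set Implicit Arguments.
Unset Strict Implicit.
Unset Printing Implicit Defensive.
Import Order.TTheory GRing.Theory Num.Theory.

Local Open Scope classical_set_scope.
Local Open Scope ring_scope.

Section Subdistributions.
Variables (R : realType) (A : choiceType).

(* [A] may be infinite, even uncountable, and a subdistribution may have
   infinite support.  Sums are [esum], the supremum of the finite partial sums;
   it is only ever applied to nonnegative terms. *)
Record subdistr := Subdistr {
  dweight :> A -> R;
  dweight_ge0 : forall a, 0 <= dweight a;
  dweight_le1 : forall a, dweight a <= 1;
  dweight_sum_le1 : (\esum_(a in [set: A]) (dweight a)%:E <= 1)%E
}.

Definition supp (f : A -> R) : set A := [set a | f a != 0].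

End Subdistributions.

Record pars (R : realType) (A : choiceType) := Pars {
  red : A -> subdistr R A -> Prop;
  red_finite_supp : forall a mu, red a mu -> finite_set (supp mu)
}.

Section Pars.
Variables (R : realType) (A : choiceType) (P : pars R A).
Implicit Types (mu nu xi rho : subdistr R A) (p : R).

Definition terminal (a : A) : Prop := ~ exists mu, red P a mu.

Definition nfpart mu : A -> R := fun a => if `[< terminal a >] then mu a else 0.

Definition activepart mu : A -> R := fun a => mu a - nfpart mu a.

Definition NF mu : \bar R := (\esum_(a in [set: A]) (nfpart mu a)%:E)%E.

(* The values of [r] outside [supp (activepart mu)] are irrelevant.  The choice
   is made once for each element [a], so all the mass of [mu] at [a] is
   rewritten with the same [r a]. *)
Definition lift_step mu nu : Prop :=
  exists r : A -> subdistr R A,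
    (forall a, supp (activepart mu) a -> red P a (r a)) /\
    (forall b, (nu b)%:E =
       ((nfpart mu b)%:E +
        \esum_(a in supp (activepart mu)) (mu a * r a b)%:E)%E).

Fixpoint lift_steps (n : nat) mu nu : Prop :=
  if n is m.+1 then exists xi, lift_step mu xi /\ lift_steps m xi nu
  else mu = nu.

Definition diamond : Prop :=
  forall mu nu xi, lift_step mu nu -> lift_step mu xi ->
    nfpart nu = nfpart xi /\
    exists rho, lift_step nu rho /\ lift_step xi rho.

Definition weakly_normalizes p mu : Prop :=
  exists rho, (exists n, lift_steps n mu rho) /\ (p%:E <= NF rho)%E.

Definition strongly_normalizes p mu : Prop :=
  exists n, forall rho, lift_steps n mu rho -> (p%:E <= NF rho)%E.

Definition uniform : Prop :=
  forall p, 0 <= p <= 1 -> forall mu,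
    weakly_normalizes p mu -> strongly_normalizes p mu.

End Pars.

(* Main.v *)
(* The key point is that one step can be permuted to the front: if mu => nu and
   mu =>^(k+1) rho, then nu reaches in k steps some sigma with the same normal
   forms as rho.  Hence two runs of equal length may be assumed to share their
   first step, which gives uniqueness by induction on the length.  Uniformity
   follows: the length of a run witnessing weak p-normalization also witnesses
   strong p-normalization. *)
Require Import Defs.
From mathcomp Require Import all_boot all_order all_algebra.
From mathcomp Require Import all_classical all_reals all_analysis.

Lemma diamond_first_step (R : realType) (A : choiceType) (P : pars R A) :
  diamond P ->
  forall (k : nat) (mu nu rho : subdistr R A),
    lift_step P mu nu -> lift_steps P k.+1 mu rho ->
    exists2 sigma, lift_steps P k nu sigma & nfpart P sigma = nfpart P rho.
Proof.
move=> hP; elim=> [|k IHk] mu nu rho mu_nu [xi [mu_xi xi_rho]].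
  (* Closing the diamond would cost one step too many here; its first clause alone applies, hence
     equal normal forms rather than equal distributions. *)
  exists nu => //; rewrite -xi_rho.
  by have [] := hP _ _ _ mu_nu mu_xi.
(* The diamond closes at [zeta], which serves the induction hypothesis at [xi] as alternative first
   step. *)
have [_ [zeta [nu_zeta xi_zeta]]] := hP _ _ _ mu_nu mu_xi.
have [sigma zeta_sigma nf_sigma] := IHk _ _ _ xi_zeta xi_rho.
by exists sigma => //; exists zeta.
Qed.

Lemma diamond_nfpart_unique (R : realType) (A : choiceType) (P : pars R A) :
  diamond P ->
  forall (k : nat) (mu rho tau : subdistr R A),
    lift_steps P k mu rho -> lift_steps P k mu tau ->
    nfpart P rho = nfpart P tau.
Proof.
move=> hP; elim=> [|k IHk] mu rho tau; first by move=> /= <- <-.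
move=> [nu [mu_nu nu_rho]] mu_tau.
have [sigma nu_sigma <-] := diamond_first_step _ _ _ hP _ _ _ _ mu_nu mu_tau.
exact: IHk nu_rho nu_sigma.
Qed.

Theorem mainTheorem3 (R : realType) (A : choiceType) (P : pars R A)
    (hP : diamond P) :
  (forall (mu rho tau : subdistr R A) (k : nat),
      lift_steps P k mu rho -> lift_steps P k mu tau ->
      nfpart P rho = nfpart P tau) /\
  uniform P.
Proof.
split=> [mu rho tau k|p _ mu [rho [[n mu_rho] p_le]]].
  exact: diamond_nfpart_unique.
exists n => tau mu_tau.
(* [NF] depends on a distribution only through its [nfpart]. *)
by rewrite /NF (diamond_nfpart_unique _ _ _ hP _ _ _ _ mu_tau mu_rho).
Qed.
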